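(* Let $p$ be a polynomial of degree $n\ge 1$ with floating point coefficients, and let $x$ be a floating point value. Assume that no underflow nor overflow occurs during the computations. Let $\overline{r}=\mathsf{CompHorner}(p,x)$, let $\widehat{r},\widehat{c},p_\pi,p_\sigma$ be the intermediate quantities of this algorithm, and let $$\widehat{\alpha}:=\operatorname{fl}\left(\frac{\widehat{\gamma}_{2n-1}\,\mathsf{Horner}(|p_\pi|\oplus|p_\sigma|,|x|)}{1-2(n+1)\mathbf{u}}\right).$$ Then: (i) If $\widehat{\alpha}<\frac{\mathbf{u}}{2}|\overline{r}|$, then $\overline{r}$ is a faithful rounding of $p(x)$. (ii) Let $e$ be the floating point value such that $\overline{r}+e=\widehat{r}+\widehat{c}$, i.e. $[\overline{r},e]=\mathsf{TwoSum}(\widehat{r},\widehat{c})$. Then the absolute error of the computed result $\overline{r}$ is bounded as follows: $$|\overline{r}-p(x)|\le\operatorname{fl}\left(\frac{\widehat{\alpha}+|e|}{1-2\mathbf{u}}\right).$$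
   Context: Floating point arithmetic. All computations are performed in one working precision of IEEE-754 binary floating point arithmetic (e.g. double precision) with rounding to the nearest. $\mathbb{F}$ is the set of all normalized floating point numbers, together with $0$. $\mathbf{u}$ is the unit roundoff, i.e. half the spacing between $1$ and the next larger floating point number ($\mathbf{u}=2^{-53}$ in double precision). $\oplus,\ominus,\otimes,\oslash$ are the floating point addition, subtraction, multiplication and division; $\operatorname{fl}(\cdot)$ denotes the result of an expression in which every operation is performed in the working precision. When no underflow nor overflow occurs, for $a,b\in\mathbb{F}$ and $\circ\in\{+,-,\times,/\}$, $\operatorname{fl}(a\circ b)=(a\circ b)(1+\varepsilon_1)=(a\circ b)/(1+\varepsilon_2)$ with $|\varepsilon_1|,|\varepsilon_2|\le\mathbf{u}$. Faithful rounding. For real $r$, $\operatorname{pred}(r)=\max\{f\in\mathbb{F}: f<r\}$ and $\operatorname{succ}(r)=\min\{f\in\mathbb{F}: r<f\}$. A floating point number $f$ is a faithful rounding of a real number $r$ if $\operatorname{pred}(f)<r<\operatorname{succ}(f)$. Constants. For a positive integer $k$ with $k\mathbf{u}<1$, $\gamma_k=\dfrac{k\mathbf{u}}{1-k\mathbf{u}}$ and $\widehat{\gamma}_k=\operatorname{fl}(\gamma_k)=(k\mathbf{u})\oslash(1\ominus k\mathbf{u})$. It is implicitly assumed that $2(n+1)\mathbf{u}<1$. Algorithms. - $\mathsf{Horner}(p,x)$, for $p=\sum_{i=0}^n a_i x^i$: $r_n=a_n$; $r_i=(r_{i+1}\otimes x)\oplus a_i$ for $i=n-1,\dots,0$; returns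 $r_0$. - $[x,y]=\mathsf{TwoSum}(a,b)$: $x=a\oplus b$; $z=x\ominus a$; $y=(a\ominus(x\ominus z))\oplus(b\ominus z)$. It is an error free transformation: $x=a\oplus b$ and $a+b=x+y$ exactly. - $[x,y]=\mathsf{Split}(a)$: $z=a\otimes(2^r+1)$; $x=z\ominus(z\ominus a)$; $y=a\ominus x$ (with $r=27$ in double precision). - $[x,y]=\mathsf{TwoProd}(a,b)$: $x=a\otimes b$; $[a_h,a_l]=\mathsf{Split}(a)$; $[b_h,b_l]=\mathsf{Split}(b)$; $y=a_l\otimes b_l\ominus(((x\ominus a_h\otimes b_h)\ominus a_l\otimes b_h)\ominus a_h\otimes b_l)$. It is an error free transformation: $x=a\otimes b$ and, if no underflow occurs, $a\times b=x+y$ exactly. - $[s_0,p_\pi,p_\sigma]=\mathsf{EFTHorner}(p,x)$, for $p=\sum_{i=0}^n a_i x^i$: $s_n=a_n$; for $i=n-1,\dots,0$: $[p_i,\pi_i]=\mathsf{TwoProd}(s_{i+1},x)$ and $[s_i,\sigma_i]=\mathsf{TwoSum}(p_i,a_i)$; $p_\pi=\sum_{i=0}^{n-1}\pi_i x^i$ and $p_\sigma=\sum_{i=0}^{n-1}\sigma_i x^i$. Here $s_0=\mathsf{Horner}(p,x)$. - $\overline{r}=\mathsf{CompHorner}(p,x)$: $[\widehat{r},p_\pi,p_\sigma]=\mathsf{EFTHorner}(p,x)$; $\widehat{c}=\mathsf{Horner}(p_\pi\oplus p_\sigma,x)$, where $p_\pi\oplus p_\sigma$ is the polynomial with coefficients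 $\pi_i\oplus\sigma_i$, $0\le i\le n-1$; $\overline{r}=\widehat{r}\oplus\widehat{c}$. $|p_\pi|\oplus|p_\sigma|$ denotes the polynomial with coefficients $|\pi_i|\oplus|\sigma_i|$, $0\le i\le n-1$. With $\widehat{b}=\mathsf{Horner}(|p_\pi|\oplus|p_\sigma|,|x|)$, the quantity $\widehat{\alpha}$ is computed as $(\widehat{\gamma}_{2n-1}\otimes\widehat{b})\oslash(1\ominus 2(n+1)\otimes\mathbf{u})$, and the bound in (ii) is computed as $(\widehat{\alpha}\oplus|e|)\oslash(1\ominus 2\otimes\mathbf{u})$. *)

(* Defs.v *)
From HB Require Import structures.
From mathcomp Require Import all_boot all_order all_algebra.
From mathcomp Require Import boolp classical_sets reals constructive_ereal ereal.

Set Implicit Arguments.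
Unset Strict Implicit.
Unset Printing Implicit Defensive.

Import Order.TTheory GRing.Theory Num.Theory.
Local Open Scope classical_set_scope.
Local Open Scope ring_scope.

(* The normalized binary numbers with t significant bits in the binade
   2 ^ e <= |x| < 2 ^ (e + 1). *)
Definition binade (R : realType) (t : nat) (e : int) : set R :=
  [set x | exists2 m : int, 2 ^+ t.-1 <= `|m| < 2 ^+ t
                          & x = m%:~R * 2 ^ (e - t%:Z + 1)].

Definition unbounded_floats (R : realType) (t : nat) : set R :=
  [set x | x = 0 \/ exists e : int, binade t e x].

Definition is_nearest (R : realType) (A : set R) (r f : R) : Prop :=
  A f /\ forall g, A g -> `|f - r| <= `|g - r|.

(* As in IEEE-754, [rnd] rounds as though the exponent range were unbounded, and
   the exponents e of the format satisfy 1 - emax <= e <= emax. Ties may be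
   resolved in any way. The two bounds on [prec] hold for all the formats of the
   standard, the smallest being prec = 11, emax = 15. *)
Record ieee_arith (R : realType) := IEEEArith {
  prec : nat;
  emax : nat;
  rnd : R -> R;
  prec_ge4 : (4 <= prec)%N;
  prec_lt_emax : (prec < emax)%N;
  rnd_nearest : forall r : R, is_nearest (unbounded_floats prec) r (rnd r)
}.

(* An arithmetic computation returns [None] as soon as one of its operations
   underflows, overflows or divides by zero. *)
Notation "'let*' x ':=' e 'in' f" := (obind (fun x => f) e)
  (at level 200, x strict pattern, e at level 200, f at level 200,
   format "'[v' 'let*'  x  ':='  e  'in' '/' f ']'").

Section FloatingPoint.
Variables (R : realType) (fp : ieee_arith R).

Definition floats : set R :=
  [set x | x = 0 \/ exists2 e : int, 1 - (emax fp)%:Z <= e <= (emax fp)%:Z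
                                   & binade (prec fp) e x].

Definition unit_roundoff : R := 2 ^ (- (prec fp)%:Z).

(* max {f in F : f < r} and min {f in F : r < f}; F is finite, and the values at
   the ends of its range, where these sets are empty, are -oo and +oo. *)
Definition fp_pred (r : R) : \bar R :=
  ereal_sup [set f%:E | f in [set f | floats f /\ f < r]].
Definition fp_succ (r : R) : \bar R :=
  ereal_inf [set f%:E | f in [set f | floats f /\ r < f]].

Definition faithful_rounding (f r : R) : Prop :=
  floats f /\ (fp_pred f < r%:E < fp_succ f)%E.

(* By the definition of [floats] (no subnormals) and of [rnd], the rounded value
   lies outside [floats] exactly when it is a nonzero number below the normalized
   range (underflow) or a number above the largest finite one (overflow). *)
Definition fl (r : R) : option R :=
  if rnd fp r \in floats then Some (rnd fp r) else None.

Definition fadd (a b : R) : option R := fl (a + b).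
Definition fsub (a b : R) : option R := fl (a - b).
Definition fmul (a b : R) : option R := fl (a * b).
Definition fdiv (a b : R) : option R := if b == 0 then None else fl (a / b).

Definition TwoSum (a b : R) : option (R * R) :=
  let* x := fadd a b in
  let* z := fsub x a in
  let* xz := fsub x z in
  let* y1 := fsub a xz in
  let* y2 := fsub b z in
  let* y := fadd y1 y2 in
  Some (x, y).

(* The splitting exponent r is half the precision, rounded up (27 for prec = 53). *)
Definition fp_split (a : R) : option (R * R) :=
  let* z := fmul a (2 ^+ uphalf (prec fp) + 1) in
  let* za := fsub z a in
  let* x := fsub z za in
  let* y := fsub a x in
  Some (x, y).

Definition TwoProd (a b : R) : option (R * R) :=
  let* x := fmul a b in
  let* (ah, al) := fp_split a in
  let* (bh, bl) := fp_split b in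
  let* hh := fmul ah bh in
  let* lh := fmul al bh in
  let* hl := fmul ah bl in
  let* ll := fmul al bl in
  let* d1 := fsub x hh in
  let* d2 := fsub d1 lh in
  let* d3 := fsub d2 hl in
  let* y := fsub ll d3 in
  Some (x, y).

(* The algorithms take a polynomial as its list of coefficients, constant term
   first; a list of length k.+1 is handled as a polynomial of formal degree k,
   even if its last entries are 0. *)
Fixpoint Horner (a : seq R) (x : R) : option R :=
  match a with
  | [::] => Some 0
  | [:: an] => Some an
  | ai :: a' =>
      let* r := Horner a' x in
      let* q := fmul r x in
      fadd q ai
  end.

Fixpoint EFTHorner (a : seq R) (x : R) : option (R * seq R * seq R) :=
  match a with
  | [::] => Some (0, [::], [::])
  | [:: an] => Some (an, [::], [::])
  | ai :: a' =>
      let* (s', ppi, psigma) := EFTHorner a' x in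
      let* (q, pi_i) := TwoProd s' x in
      let* (s, sigma_i) := TwoSum q ai in
      Some (s, pi_i :: ppi, sigma_i :: psigma)
  end.

(* Coefficientwise sum of two lists of the same length. *)
Fixpoint poly_fadd (a b : seq R) : option (seq R) :=
  match a, b with
  | ai :: a', bi :: b' =>
      let* c := fadd ai bi in
      let* c' := poly_fadd a' b' in
      Some (c :: c')
  | _, _ => Some [::]
  end.

Definition correction (ppi psigma : seq R) (x : R) : option R :=
  let* q := poly_fadd ppi psigma in Horner q x.

Definition CompHorner (a : seq R) (x : R) : option R :=
  let* (rhat, ppi, psigma) := EFTHorner a x in
  let* chat := correction ppi psigma x in
  fadd rhat chat.

Definition gamma_hat (k : nat) : option R :=
  let* ku := fmul k%:R unit_roundoff in
  let* d := fsub 1 ku in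
  fdiv ku d.

Definition alpha_hat (n : nat) (ppi psigma : seq R) (x : R) : option R :=
  let* q := poly_fadd [seq `|c| | c <- ppi] [seq `|c| | c <- psigma] in
  let* b := Horner q `|x| in
  let* g := gamma_hat (2 * n - 1) in
  let* gb := fmul g b in
  let* v := fmul (2 * (n + 1))%:R unit_roundoff in
  let* d := fsub 1 v in
  fdiv gb d.

Definition error_bound (alpha e : R) : option R :=
  let* s := fadd alpha `|e| in
  let* v := fmul 2 unit_roundoff in
  let* d := fsub 1 v in
  fdiv s d.

End FloatingPoint.

(* Main.v *)
Require Import Defs.
From HB Require Import structures.
From mathcomp Require Import all_boot all_order all_algebra.
From mathcomp Require Import boolp classical_sets reals constructive_ereal ereal.
From mathcomp Require Import zify ring lra.

Import Order.TTheory GRing.Theory Num.Theory.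
Local Open Scope ring_scope.

(** All the rounding errors of the Horner scheme are known exactly, so that [p(x)]
    is [rhat] plus a correction, and the only inexact quantity before the last
    addition is the computed correction [chat].

    Since [TwoProd] and [TwoSum] return their own rounding errors exactly,
    induction along the scheme gives [p(x) = rhat + c], where [c] is the value at
    [x] of the polynomial with coefficients [pi_i + sigma_i] ([EFTHorner_exact]).
    Only [c] is computed approximately. Each term of [chat] undergoes at most
    [2n - 1] roundings, so [|chat - c| <= ((1 + u)^(2n-1) - 1) B], with [B] the
    value at [|x|] of the polynomial with coefficients [|pi_i| + |sigma_i|]
    ([correction_approx]), and the factor of [B] is at most [gamma_(2n-1)]. The
    same count bounds [B] by [(1 + u)^(2n-1)] times its computed value
    ([abs_correction_upper]). Three more factors [1 + u] pay for
    the division in [gamma], the product and the last division in [alpha], and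
    dividing by [1 - (2n + 2) u] absorbs all [2n + 2] of them, because
    [(1 + u)^k (1 - k u) <= 1] ([pow_1Du_le1]). Hence [|chat - c| <= alpha]
    ([alpha_hat_bound]).

    For (i), [rbar] is a nearest float to [rhat + chat], and [p(x)] differs from
    this sum by at most [alpha]. A float other than [rbar] is at least
    [u |rbar|] away from [rbar], and half of this gap separates it from
    [rhat + chat]; a perturbation below [u |rbar| / 2] therefore cannot reach it
    ([faithful_perturbation]). For (ii), [rbar - p(x) = (chat - c) - e], and the
    division by [1 - 2u] pays for the two remaining roundings.

    The substance is the exactness of [TwoSum] and [TwoProd] when every tie may
    be broken in any way. Operations that neither underflow nor overflow round as
    if the exponent range were unbounded, so that a float is a multiple of some
    [2 ^ k] of absolute value at most [2 ^ (k + prec)]. To show that an operation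
    is exact, it suffices to find a power of two dividing its exact result and to
    bound this result; the bounds come from half-ulp estimates, which hold for
    any choice of the nearest float. *)

(** * Binary grids *)

Section Grid.
Set Implicit Arguments.
Unset Strict Implicit.
Context {R : realType}.
Implicit Types (x y : R) (k l : int).

Lemma pow2_gt0 k : 0 < 2 ^ k :> R.
Proof. exact: exprz_gt0. Qed.

Lemma pow2D k l : 2 ^ (k + l) = 2 ^ k * 2 ^ l :> R.
Proof. by rewrite expfzDr. Qed.

Lemma pow2S k : 2 ^ (k + 1) = 2 ^ k * 2 :> R.
Proof. by rewrite pow2D expr1z. Qed.

Lemma pow2_pred k : 2 ^ (k - 1) = 2 ^ k / 2 :> R.
Proof. by rewrite pow2D -exprnN expr1. Qed.

Lemma pow2_lt k l : (2 ^ k < 2 ^ l :> R) = (k < l).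
Proof. by apply: ltr_eXz2l; lra. Qed.

Definition on_grid k x := x / 2 ^ k \is a Num.int.

Lemma gridD k x y : on_grid k x -> on_grid k y -> on_grid k (x + y).
Proof. by rewrite /on_grid mulrDl; apply: rpredD. Qed.

Lemma gridN k x : on_grid k (- x) = on_grid k x.
Proof. by rewrite /on_grid mulNr rpredN. Qed.

Lemma gridB k x y : on_grid k x -> on_grid k y -> on_grid k (x - y).
Proof. by rewrite -(gridN _ y); apply: gridD. Qed.

Lemma grid_norm k x : on_grid k `|x| = on_grid k x.
Proof. by case: (ger0P x) => // _; rewrite gridN. Qed.

Lemma gridM k l x y : on_grid k x -> on_grid l y -> on_grid (k + l) (x * y).
Proof. by rewrite /on_grid pow2D invfM mulrACA; apply: rpredM. Qed.

Lemma grid_pow2 k : on_grid k (2 ^ k).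
Proof. by rewrite /on_grid divff ?rpred1// gt_eqF ?pow2_gt0. Qed.

Lemma grid_nat (n : nat) : on_grid 0 n%:R.
Proof. by rewrite /on_grid expr0z divr1 rpred_nat. Qed.

Lemma grid_le k l x : l <= k -> on_grid k x -> on_grid l x.
Proof.
move=> lk xk; suff: on_grid (k + (l - k)) (x * 1) by rewrite mulr1 addrC subrK.
apply: gridM => //; rewrite /on_grid div1r invr_expz opprB.
have -> : k - l = `|k - l|%N :> int by lia.
by rewrite -exprnP rpredX// rpred_nat.
Qed.

Lemma grid_pred k x : on_grid k x -> on_grid (k - 1) x.
Proof. by apply: grid_le; rewrite gerBl. Qed.

Lemma grid_addn k (n : nat) x : on_grid (k + n%:Z) x -> on_grid k x.
Proof. by apply: grid_le; rewrite lerDl. Qed.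

(** Two neighbours on a grid are a full step apart, so that an error below one
    step can be dropped from a bound that lies on the grid itself. *)
Lemma grid_norm_le k x y :
  on_grid k x -> on_grid k y -> `|x| < y + 2 ^ k -> `|x| <= y.
Proof.
rewrite -(grid_norm _ x) /on_grid => /intrP[m xm] /intrP[n yn].
have k0 := pow2_gt0 k; have kN0 : 2 ^ k != 0 :> R by rewrite gt_eqF.
have -> : y = n%:~R * 2 ^ k by rewrite -yn divfK.
have -> : `|x| = m%:~R * 2 ^ k by rewrite -xm divfK.
rewrite -[X in _ + X]mul1r -mulrDl ltr_pM2r// ler_pM2r//.
by rewrite -[1]/(1%:~R) -intrD ltr_int ler_int; lia.
Qed.

Lemma exists_binade x : 0 < x -> exists k, 2 ^ k <= x < 2 ^ (k + 1).
Proof.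
move=> x0.
pose n := maxn (Num.bound x) (Num.bound x^-1).
have xn : x < 2 ^+ n by apply: upper_nthrootP; exact: leq_maxl.
have nx : x^-1 < 2 ^+ n by apply: upper_nthrootP; exact: leq_maxr.
pose P j := x < 2 ^ (j%:Z - n%:Z).
have exP : exists j, P j.
  exists (n + n)%N; rewrite /P; have -> : (n + n)%:Z - n%:Z = n :> int by lia.
  by rewrite -exprnP.
case: (ex_minnP exP) => -[|j] Pj minj.
  have : 2 ^ (- n%:Z) < x :> R.
    by rewrite -exprnN invf_plt// posrE exprn_gt0.
  by move: Pj; rewrite /P sub0r => /ltW/le_lt_trans h /h; rewrite ltxx.
exists (j%:Z - n%:Z); rewrite leNgt; apply/andP; split.
  by apply/negP => /minj; rewrite ltnn.
by move: Pj; rewrite /P; congr (_ < 2 ^ _); lia.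
Qed.

End Grid.

(** * Floats with unbounded exponents and rounding to nearest *)

Section Rounding.
Set Implicit Arguments.
Unset Strict Implicit.
Context {R : realType} (p : nat).
Hypothesis p_ge4 : (4 <= p)%N.
Implicit Types (a b r f x y z : R) (k : int).

Local Notation float := (unbounded_floats (R := R) p).
Local Notation nearest := (is_nearest float).
Local Notation P := (2 ^+ p).

Lemma prec_pow2_ge16 : 16 <= P :> R.
Proof.
have -> : 16 = 2 ^+ 4 :> R by ring.
by apply: ler_weXn2l => //; lra.
Qed.

Lemma prec_pow2_gt0 : 0 < P :> R.
Proof. exact: exprn_gt0. Qed.

Lemma prec_pow2_half : 2 ^+ p.-1 = P / 2 :> R.
Proof. by rewrite -[in RHS](@prednK p) 1?exprSr; [field | lia]. Qed.

Lemma pow2D_prec k : 2 ^ (k + p%:Z) = 2 ^ k * P :> R.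
Proof. by rewrite pow2D. Qed.

Lemma grid_pow2_prec k : on_grid k (2 ^ k * P : R).
Proof. by rewrite -pow2D_prec; apply: grid_addn (grid_pow2 _). Qed.

Lemma grid_pow2_prec_half k : on_grid k (2 ^ k * P / 2 : R).
Proof.
rewrite -pow2D_prec -pow2_pred; have -> : k + p%:Z - 1 = k + p.-1%:Z by lia.
exact: grid_addn (grid_pow2 _).
Qed.

(** The bound is not strict because [2 ^ (k + p)], although its significand
    exceeds the range for the exponent [k], has a shorter one for a larger
    exponent. This makes it unnecessary to know the binade of [x]. *)
Lemma grid_float k x : on_grid k x -> `|x| <= 2 ^ k * P -> float x.
Proof.
have k0 := pow2_gt0 (R := R) k; have kN0 : 2 ^ k != 0 :> R by rewrite gt_eqF.
move=> /intrP[m xm]; have {xm} -> : x = m%:~R * 2 ^ k by rewrite -xm divfK.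
rewrite normrM (gtr0_norm k0) mulrC ler_pM2l// -intr_norm.
rewrite -natr_absz -natrX ler_nat => mP.
have [->|m0] := eqVneq m 0; first by left; rewrite mul0r.
right; pose t := trunc_log 2 `|m|%N.
have /andP[tm mt] : (2 ^ t <= `|m| < 2 ^ t.+1)%N.
  by apply: trunc_log_bounds => //; lia.
have tp : (t <= p)%N by rewrite -(leq_exp2l _ _ (isT : (1 < 2)%N)); lia.
exists (k + t%:Z).
have [tpE|tp'] := eqVneq t p.
  have mE : (`|m| = 2 ^ p)%N by apply/eqP; rewrite eqn_leq mP -tpE tm.
  (* [`|m|] has one bit too many, but it is a power of two. *)
  exists (Num.sg m * 2 ^+ p.-1).
    rewrite normrM normr_sg m0 mul1r ger0_norm ?exprn_ge0// lexx /=.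
    by rewrite ltr_eXn2l//; lia.
  have -> : m%:~R = (Num.sg m * 2 ^+ p)%:~R :> R.
    by rewrite [in LHS](numEsg m) -abszE mE -natz natrX.
  rewrite !rmorphM !rmorphXn /= tpE addrK.
  have -> : k + 1 = 1 + k by rewrite addrC.
  rewrite prec_pow2_half pow2D expr1z; by field.
have {}tp : (t <= p.-1)%N by lia.
exists (m * 2 ^+ (p.-1 - t)).
  rewrite normrM (ger0_norm (exprn_ge0 _ _))// .
  have -> : `|m| = `|m|%N%:Z by lia.
  have E n : 2 ^+ n = (2 ^ n)%N%:Z :> int by rewrite -natz natrX.
  rewrite !E -PoszM !lez_nat ltz_nat.
  rewrite -[X in (X <= _)%N](_ : 2 ^ t * 2 ^ (p.-1 - t) = _)%N; last first.
    by rewrite -expnD subnKC.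
  rewrite -[X in (_ < X)%N](_ : 2 ^ t.+1 * 2 ^ (p.-1 - t) = _)%N; last first.
    by rewrite -expnD; congr (expn 2 _); lia.
  by rewrite leq_mul2r ltn_mul2r mt tm expn_gt0 orbT.
rewrite rmorphM rmorphXn /= -mulrA; congr (_ * _).
rewrite exprnP -pow2D; congr (2 ^ _); lia.
Qed.

Lemma float0 : float 0.
Proof. by left. Qed.

Lemma float_normal x : float x -> x != 0 ->
  exists2 k, on_grid k x & 2 ^ k * P / 2 <= `|x| < 2 ^ k * P.
Proof.
case=> [->|[e [m /andP[m1 m2] ->]]]; first by rewrite eqxx.
move=> _; set k := _ + 1; exists k.
  by rewrite /on_grid mulfK ?intr_int// gt_eqF ?pow2_gt0.
have k0 := pow2_gt0 (R := R) k.
rewrite normrM (gtr0_norm k0) [_ * 2 ^ k]mulrC -mulrA -prec_pow2_half.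
have E n : 2 ^+ n = (2 ^+ n : int)%:~R :> R by rewrite rmorphXn.
rewrite ler_pM2l// ltr_pM2l// -intr_norm.
by rewrite !E ler_int ltr_int m1.
Qed.

Lemma float_grid k x : float x -> 2 ^ k * P / 2 <= `|x| -> on_grid k x.
Proof.
move=> /float_normal Fx kx; have k0 := pow2_gt0 (R := R) k.
have x0 : x != 0 by rewrite -normr_gt0; have := mulr_gt0 k0 prec_pow2_gt0; lra.
have [l lx /andP[_ xl]] := Fx x0.
apply: grid_le lx.
have : 2 ^ (k - 1) < 2 ^ l :> R by rewrite pow2_pred -(ltr_pM2r prec_pow2_gt0); lra.
by rewrite pow2_lt; lia.
Qed.

Lemma floatN x : float (- x) <-> float x.
Proof.
have imp y : float y -> float (- y).
  move=> Fy; have [->|y0] := eqVneq y 0; first by rewrite oppr0; left.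
  have [k ky /andP[_ /ltW yk]] := float_normal Fy y0.
  by apply: (@grid_float k); rewrite ?gridN ?normrN.
by split=> /imp //; rewrite opprK.
Qed.

Lemma float_norm x : float x -> float `|x|.
Proof. by case: (ger0P x) => // _ /floatN. Qed.

Lemma float_pow2 k : float (2 ^ k).
Proof.
apply: (@grid_float k); first exact: grid_pow2.
rewrite gtr0_norm ?pow2_gt0// ler_peMr ?ltW ?pow2_gt0//.
have := prec_pow2_ge16; lra.
Qed.

Lemma nearest_opp r f : nearest r f -> nearest (- r) (- f).
Proof.
case=> Ff minf; split; first exact/floatN.
move=> g Fg; have -> : - f - - r = - (f - r) by ring.
have -> : g - - r = - (- g - r) by ring.
by rewrite !normrN; apply: minf; apply/floatN.
Qed.

Lemma nearest_float r f : nearest r f -> float r -> f = r.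
Proof.
case=> _ minf /minf; rewrite subrr normr0 normr_le0 subr_eq0 => /eqP //.
Qed.

(** Rounding to nearest cannot cross a number that needs no rounding. *)
Lemma nearest_norm_ge r f x : nearest r f -> float x -> x <= `|r| -> x <= `|f|.
Proof.
wlog r0 : r f / 0 <= r => [hw rf Fx|].
  have [/hw|/ltW r0] := lerP 0 r; first exact.
  rewrite -normrN -(normrN f) => /hw; apply => //; last exact: nearest_opp.
  by rewrite oppr_ge0.
case=> _ minf Fx; rewrite (ger0_norm r0) => xr.
apply: le_trans (ler_norm f); rewrite leNgt; apply/negP => fx.
have := minf x Fx; rewrite distrC (distrC x) !ger0_norm; lra.
Qed.

(** The multiple of [2 ^ k] closest to [r] is itself a float. *)
Lemma nearest_half_ulp k r f :
  nearest r f -> `|r| <= 2 ^ k * P -> `|f - r| <= 2 ^ k / 2.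
Proof.
case=> _ minf rk; have k0 := pow2_gt0 (R := R) k.
have kN0 : 2 ^ k != 0 :> R by rewrite gt_eqF.
pose g := (Num.floor (r / 2 ^ k + 1 / 2))%:~R * 2 ^ k : R.
have gr : `|g - r| <= 2 ^ k / 2.
  have /andP[] := floor_itv (r / 2 ^ k + 1 / 2); rewrite intrD mulr1z -/g => h1 h2.
  have -> : r = r / 2 ^ k * 2 ^ k by rewrite divfK.
  rewrite -mulrBl normrM (gtr0_norm k0) mulrC ler_pM2l// ler_norml.
  by apply/andP; split; lra.
apply: le_trans (minf g _) (gr); apply: (@grid_float k).
  by rewrite /on_grid mulfK// intr_int.
apply: (@grid_norm_le _ k); first by rewrite /on_grid mulfK// intr_int.
  exact: grid_pow2_prec.
have := ler_normD r (g - r); rewrite [r + _]addrC subrK; lra.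
Qed.

Lemma nearest_grid_ge k r f :
  nearest r f -> 2 ^ k * P / 2 <= `|r| -> on_grid k f.
Proof.
move=> rf kr; apply: float_grid; first by case: rf.
apply: nearest_norm_ge kr => //.
have -> : 2 ^ k * P / 2 = 2 ^ (k + p%:Z - 1) :> R by rewrite pow2_pred pow2D_prec.
exact: float_pow2.
Qed.

(** Either [r] is a float, or it is so large that all floats near it lie on a
    coarser grid. *)
Lemma nearest_grid k r f : nearest r f -> on_grid k r -> on_grid k f.
Proof.
move=> rf kr; have [rk|/ltW rk] := lerP `|r| (2 ^ k * P).
  by rewrite (nearest_float rf) //; exact: grid_float rk.
apply: (@grid_addn _ k 1).
apply: nearest_grid_ge rf _; rewrite pow2S; lra.
Qed.

(** Rounding never moves a number into a lower binade, so the half-ulp bound can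
    also be read off the result. *)
Lemma nearest_half_ulp_float k r f :
  nearest r f -> `|f| < 2 ^ k * P -> `|f - r| <= 2 ^ k / 2.
Proof.
move=> rf fk; have [rk|/ltW rk] := lerP `|r| (2 ^ k * P).
  exact: nearest_half_ulp rf rk.
have Fk : float (2 ^ k * P) by rewrite -pow2D_prec; exact: float_pow2.
by have := nearest_norm_ge rf Fk rk; rewrite leNgt fk.
Qed.

Local Notation u := (2 ^ (- p%:Z)).

Lemma roundoff_gt0 : 0 < u :> R.
Proof. exact: pow2_gt0. Qed.

Lemma roundoffE : u * P = 1 :> R.
Proof. by rewrite exprnP -pow2D addNr expr0z. Qed.

Lemma nearest_relative r f :
  nearest r f -> `|f - r| <= u * `|r| /\ `|f - r| <= u * `|f|.
Proof.
move=> rf; have [r0|r0] := eqVneq r 0.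
  have -> : f = 0 by rewrite -r0; apply: nearest_float rf _; rewrite r0; left.
  by rewrite r0 subrr normr0 mulr0.
have [|k] := @exists_binade _ `|r|; first by rewrite normr_gt0.
have u0 := roundoff_gt0; have uP := roundoffE; have P0 := prec_pow2_gt0.
rewrite pow2S => /andP[kr rk]; pose l : int := k - p%:Z + 1.
have kl : 2 ^ k = 2 ^ l * P / 2 :> R.
  rewrite -pow2D_prec -pow2_pred; congr (2 ^ _); rewrite /l; lia.
clearbody l.
have rl : `|r| <= 2 ^ l * P by lra.
have ul : 2 ^ l / 2 = u * 2 ^ k :> R.
  rewrite kl [2 ^ l * _ / 2]mulrAC mulrCA mulrA.
  by rewrite -mulrA uP mulr1.
have fl : 2 ^ k <= `|f| by apply: nearest_norm_ge rf (float_pow2 _) kr.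
have := nearest_half_ulp rf rl; rewrite ul => h.
by split; apply: (le_trans h); rewrite ler_pM2l.
Qed.

(** The relative spacing decreases to just above [u] at the end of each binade; it
    is exactly [u] only from a power of two [f] to the float just below it. *)
Lemma float_gap f x : float f -> float x -> x != f -> u * `|f| <= `|f - x|.
Proof.
move=> Ff Fx xf; rewrite leNgt; apply/negP => gap.
have P16 := prec_pow2_ge16.
have f0 : f != 0.
  by apply: contraTneq gap => ->; rewrite normr0 mulr0 -leNgt normr_ge0.
have [k kf /andP[kf1 kf2]] := float_normal Ff f0.
have k0 := pow2_gt0 (R := R) k.
have uk : u * (2 ^ k * P) = 2 ^ k :> R by rewrite mulrCA roundoffE mulr1.
have fx : `|f| <= `|x| + `|f - x| by rewrite addrC -lerBlDr lerB_dist.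
have gapk : `|f - x| < 2 ^ k.
  by apply: (lt_trans gap); rewrite -[ltRHS]uk ltr_pM2l ?roundoff_gt0.
have step l : on_grid l f -> on_grid l x -> 2 ^ l <= `|f - x|.
  move=> lf lx; rewrite leNgt; apply/negP => h.
  have l0 : on_grid l (0 : R) by rewrite /on_grid mul0r rpred0.
  have := grid_norm_le (gridB lf lx) l0; rewrite add0r => /(_ h).
  by rewrite normr_le0 subr_eq0 eq_sym (negbTE xf).
(* Just below a power of two the spacing of the floats is half of the spacing
   above it. *)
have kx : on_grid (k - 1) x by apply: float_grid => //; rewrite pow2_pred; nra.
have half : 2 ^ k / 2 <= `|f - x|.
  by rewrite -pow2_pred; apply: step (grid_pred kf) kx.
have fk : 2 ^ k * P / 2 < `|f|.
  rewrite -(ltr_pM2l roundoff_gt0) mulrA uk; exact: le_lt_trans gap.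
have kxf : on_grid k x.
  apply: float_grid => //.
  suff : 2 ^ k * P / 2 + 2 ^ k <= `|f| by lra.
  rewrite leNgt; apply/negP => /(grid_norm_le kf) h.
  have : `|f| <= 2 ^ k * P / 2.
    exact: h (grid_pow2_prec_half _).
  lra.
have := step k kf kxf; lra.
Qed.

(** * Exactness of the sum *)

(** The error lies on the grid of the smaller operand, and it is no larger than
    this operand because the larger one is a competing approximation. *)
Lemma sum_rounding_error_float a b x :
  float a -> float b -> nearest (a + b) x -> float (a + b - x).
Proof.
wlog ba : a b / `|b| <= `|a| => [hw Fa Fb abx|].
  have [/hw|/ltW/hw] := lerP `|b| `|a|; first exact.
  by rewrite [b + a]addrC; exact.
move=> Fa Fb abx; have [b0|b0] := eqVneq b 0.
  move: abx; rewrite b0 addr0 => /nearest_float -> //.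
  by rewrite subrr; exact: float0.
have [k kb /andP[kb1 kb2]] := float_normal Fb b0.
have ka : on_grid k a by apply: float_grid => //; lra.
have kab := gridD ka kb.
apply: (@grid_float k); first by apply: gridB => //; exact: nearest_grid abx kab.
have [_ /(_ a Fa)] := abx; have -> : a - (a + b) = - b by ring.
by rewrite normrN distrC => h; lra.
Qed.

(** If the ulp of [x] is at most that of [a], the difference lies on the grid of
    [x], and either [b] is small enough for the difference to be a float or the
    sum itself is exact. Otherwise the binade of [x] is just above that of [a], so
    the difference lies on the grid of [a] and hardly exceeds [b]. *)
Lemma sum_sub_larger_float a b x :
  float a -> float b -> `|b| <= `|a| -> nearest (a + b) x -> float (x - a).
Proof.
move=> Fa Fb ba abx; have Fx : float x by case: abx.
have [x0|x0] := eqVneq x 0; first by rewrite x0 sub0r; apply/floatN.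
have [a0|a0] := eqVneq a 0; first by rewrite a0 subr0.
have [k ka /andP[ka1 ka2]] := float_normal Fa a0.
have [l lx /andP[lx1 lx2]] := float_normal Fx x0.
have k0 := pow2_gt0 (R := R) k; have l0 := pow2_gt0 (R := R) l.
have P0 := prec_pow2_gt0.
have tri : `|x - a| <= `|x - (a + b)| + `|b|.
  by have := ler_normD (x - (a + b)) b; have -> : x - (a + b) + b = x - a by ring.
have errl := nearest_half_ulp_float abx lx2.
have [kl|lk] := ltP k l.
  have err : `|x - (a + b)| <= 2 ^ k.
    have -> : 2 ^ k = 2 ^ (k + 1) / 2 :> R by rewrite pow2S; field.
    apply: nearest_half_ulp abx _.
    by have := ler_normD a b; rewrite pow2S; lra.
  have kxa : on_grid k (x - a) by apply: gridB => //; apply: grid_le lx; exact: ltW.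
  apply: (@grid_float k) => //; apply: grid_norm_le kxa (grid_pow2_prec _) _.
  by lra.
have lxa : on_grid l (x - a) by apply: gridB => //; apply: grid_le ka.
have [bl|lb] := lerP `|b| (2 ^ l * P).
  apply: (@grid_float l) => //; apply: grid_norm_le lxa (grid_pow2_prec _) _.
  by lra.
have la' : on_grid (l + 1) a by apply: float_grid => //; rewrite pow2S; lra.
have lb' : on_grid (l + 1) b by apply: float_grid => //; rewrite pow2S; lra.
suff Fab : float (a + b).
  by rewrite (nearest_float abx Fab); have -> : a + b - a = b by ring.
apply: (@grid_float (l + 1)); first exact: gridD.
have := ler_normD (a + b - x) x; rewrite subrK pow2S distrC.
have := prec_pow2_ge16; nra.
Qed.

(** If [b] is the smaller operand, [z] is exactly [x - a] and the rest is exact.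
    If [a] is smaller, [z] may be inexact, but the first three operations then
    form an error-free transformation of the sum of [x] and [- a], as [x] is
    the larger of these two unless [a + b] is itself a float. *)
Lemma two_sum_exact a b x z xz y1 y2 y :
  float a -> float b ->
  nearest (a + b) x -> nearest (x - a) z -> nearest (x - z) xz ->
  nearest (a - xz) y1 -> nearest (b - z) y2 -> nearest (y1 + y2) y ->
  y = a + b - x.
Proof.
move=> Fa Fb abx Nz Nxz Ny1 Ny2 Ny.
have Ferr := sum_rounding_error_float Fa Fb abx.
have [ba|ab] := lerP `|b| `|a|.
  have zE : z = x - a := nearest_float Nz (sum_sub_larger_float Fa Fb ba abx).
  move: Nxz; rewrite zE; have -> : x - (x - a) = a by ring.
  move=> /nearest_float /(_ Fa) xzE; move: Ny1; rewrite xzE subrr.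
  move=> /nearest_float /(_ float0) y1E; move: Ny2 Ny; rewrite zE y1E add0r.
  have -> : b - (x - a) = a + b - x by ring.
  by move=> /nearest_float -> // /nearest_float; exact.
have [aab|/ltW aba] := lerP `|a| `|a + b|; last first.
  have Fab : float (a + b).
    have [->|a0] := eqVneq a 0; first by rewrite add0r.
    have [k ka /andP[ka1 ka2]] := float_normal Fa a0.
    apply: (@grid_float k); last by lra.
    by apply: gridD => //; apply: float_grid => //; lra.
  have xE := nearest_float abx Fab.
  move: Nz; rewrite xE [a + b]addrC addrK => /nearest_float /(_ Fb) zE.
  move: Nxz; rewrite xE zE addrK => /nearest_float /(_ Fa) xzE.
  move: Ny1 Ny2 Ny; rewrite zE xzE !subrr.
  move=> /nearest_float -> //; last exact: float0.
  move=> /nearest_float -> //; last exact: float0.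
  by rewrite addr0 => /nearest_float -> //; exact: float0.
have Fx : float x by case: abx.
have FNa : float (- a) by apply/floatN.
have ax : `|- a| <= `|x|.
  by rewrite normrN; apply: nearest_norm_ge abx _ aab; exact: float_norm.
have xzE : xz = x - z.
  apply: nearest_float Nxz _; rewrite -opprB; apply/floatN.
  exact: sum_sub_larger_float Fx FNa ax Nz.
have y1E : y1 = a - x + z.
  have -> : y1 = a - xz; last by rewrite xzE; ring.
  apply: nearest_float Ny1 _; have := sum_rounding_error_float Fx FNa Nz.
  by rewrite xzE -floatN; congr (float _); ring.
have b0 : b != 0 by rewrite -normr_gt0; apply: le_lt_trans ab.
have [k kb /andP[kb1 kb2]] := float_normal Fb b0.
have k0 := pow2_gt0 (R := R) k; have P16 := prec_pow2_ge16.
have kP : 2 ^ k * 16 <= 2 ^ k * P :> R by rewrite ler_pM2l.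
have kE : 2 ^ k = 2 ^ (k + 1) / 2 :> R by rewrite pow2S; field.
have err1 : `|x - (a + b)| <= 2 ^ k.
  rewrite kE; apply: nearest_half_ulp abx _.
  by have := ler_normD a b; rewrite pow2S; lra.
have err2 : `|z - (x - a)| <= 2 ^ k.
  rewrite kE; apply: nearest_half_ulp Nz _.
  have := ler_normD (x - (a + b)) b; have -> : x - (a + b) + b = x - a by ring.
  by rewrite pow2S; lra.
have bz : `|b - z| <= 2 ^ k * 2.
  have := ler_normD (x - (a + b)) (z - (x - a)).
  have -> : x - (a + b) + (z - (x - a)) = z - b by ring.
  by rewrite [`|z - b|]distrC; lra.
have kz : on_grid (k - 1) z.
  apply: float_grid; first by case: Nz.
  by have := ler_normD (b - z) z; rewrite subrK pow2_pred; lra.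
have y2E : y2 = b - z.
  apply: nearest_float Ny2 _; apply: (@grid_float (k - 1)).
    by apply: gridB => //; exact: grid_pred.
  by rewrite pow2_pred; lra.
rewrite (nearest_float Ny) y1E y2E; first by ring.
by move: Ferr; congr (float _); ring.
Qed.

(** * Exactness of the product *)

(** The head is [z - za = a - (za - (z - a))]: the error of [z] cancels, and only
    the error of [za], at most half a step of the grid [k + s], separates [ah]
    from [a]. *)
Lemma veltkamp_split (s : nat) k a z za ah al :
  (s < p)%N -> on_grid k a -> 2 ^ k * P / 2 <= `|a| < 2 ^ k * P ->
  nearest (a * (2 ^+ s + 1)) z -> nearest (z - a) za ->
  nearest (z - za) ah -> nearest (a - ah) al ->
  [/\ on_grid (k + s) ah, `|ah| <= 2 ^ k * P,
      al = a - ah & `|al| <= 2 ^ k * 2 ^+ s / 2].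
Proof.
move=> sp ka /andP[ka1 ka2] Nz Nza Nah Nal.
have k0 := pow2_gt0 (R := R) k; have P0 := prec_pow2_gt0.
have S1 : 1 <= 2 ^+ s :> R by apply: exprn_ege1; lra.
have SP : 2 ^+ s * 2 <= P :> R by rewrite -exprSr; apply: ler_weXn2l; lra || lia.
have ksE : 2 ^ (k + s) = 2 ^ k * 2 ^+ s :> R by rewrite pow2D.
have kS : 2 ^ k <= 2 ^ k * 2 ^+ s :> R by rewrite ler_peMr// ltW.
have kSP : 2 ^ k * 2 ^+ s * 2 <= 2 ^ k * P :> R by rewrite -mulrA ler_pM2l.
have aS : 2 ^ k * 2 ^+ s * P / 2 <= `|a * 2 ^+ s|.
  rewrite normrM [`|2 ^+ s|]ger0_norm ?exprn_ge0//.
  have -> : 2 ^ k * 2 ^+ s * P / 2 = 2 ^ k * P / 2 * 2 ^+ s :> R by ring.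
  by apply: ler_wpM2r ka1; lra.
have nC : `|a * (2 ^+ s + 1)| = `|a| * 2 ^+ s + `|a|.
  by rewrite normrM [`|2 ^+ s + 1|]ger0_norm ?addr_ge0 ?exprn_ge0// mulrDr mulr1.
have nS : `|a * 2 ^+ s| = `|a| * 2 ^+ s.
  by rewrite normrM [`|2 ^+ s|]ger0_norm ?exprn_ge0.
have kPE : 2 ^ k * P / 2 = 2 ^ (k + p%:Z - 1) :> R by rewrite pow2_pred pow2D_prec.
have ka3 : `|a| <= 2 ^ k * P - 2 ^ k.
  apply: grid_norm_le ka _ _; last by rewrite subrK.
  exact: gridB (grid_pow2_prec _) (grid_pow2 _).
have ka4 : `|a| * 2 ^+ s <= 2 ^ k * 2 ^+ s * P - 2 ^ k * 2 ^+ s.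
  have -> : 2 ^ k * 2 ^+ s * P - 2 ^ k * 2 ^+ s = (2 ^ k * P - 2 ^ k) * 2 ^+ s :> R.
    by ring.
  by apply: ler_wpM2r ka3; lra.
have ksP : 2 ^ k * P <= 2 ^ k * 2 ^+ s * P :> R by rewrite ler_pM2r.
have zS : on_grid (k + s) z by apply: nearest_grid_ge Nz _; rewrite ksE nC; lra.
have zerr : `|z - a * (2 ^+ s + 1)| <= 2 ^ k * 2 ^+ s.
  have -> : 2 ^ k * 2 ^+ s = 2 ^ (k + s + 1) / 2 :> R by rewrite pow2S ksE; field.
  by apply: nearest_half_ulp Nz _; rewrite pow2S ksE nC; lra.
have zaE : z - a = a * 2 ^+ s + (z - a * (2 ^+ s + 1)) by ring.
have za_le : `|z - a| <= 2 ^ (k + s) * P.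
  by rewrite zaE ksE; apply: le_trans (ler_normD _ _) _; lra.
(* The error of [z] could carry [z - a] into the binade below only if [`|a|] were
   a power of two, and then [z] is exact. *)
have za_ge : 2 ^ (k + s) * P / 2 <= `|z - a|.
  have [ka5|ka5] := eqVneq `|a| (2 ^ (k + p%:Z - 1)).
    have -> : z = a * (2 ^+ s + 1).
      apply: nearest_float Nz _; apply: (@grid_float (k + p%:Z - 1)).
        rewrite -[_ - 1]addr0; apply: gridM.
          by rewrite -grid_norm ka5 grid_pow2.
        by rewrite -natrX -[1]/(1%:R) -natrD grid_nat.
      rewrite nC -kPE; have -> : `|a| = 2 ^ k * P / 2 by rewrite kPE.
      rewrite -[X in _ + X]mulr1 -mulrDr ler_pM2l; first lra.
      by rewrite divr_gt0 ?mulr_gt0.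
    by rewrite mulrDr mulr1 addrK ksE.
  have ka6 : 2 ^ k * P / 2 + 2 ^ k <= `|a|.
    rewrite leNgt; apply/negP => /(grid_norm_le ka) h.
    move/negP: ka5; apply; rewrite eq_le -kPE ka1 andbT; apply: h.
    exact: grid_pow2_prec_half.
  have ka7 : (2 ^ k * P / 2 + 2 ^ k) * 2 ^+ s <= `|a| * 2 ^+ s.
    by apply: ler_wpM2r ka6; lra.
  have := ler_normD (z - a) (a * (2 ^+ s + 1) - z).
  have -> : z - a + (a * (2 ^+ s + 1) - z) = a * 2 ^+ s by ring.
  rewrite [`|_ - z|]distrC nS ksE; lra.
have zaS : on_grid (k + s) za := nearest_grid_ge Nza za_ge.
have zaerr := nearest_half_ulp Nza za_le; rewrite ksE in zaerr.
have kzza := gridB zS zaS.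
have zza : `|z - za| <= 2 ^ k * P.
  have kPs : on_grid (k + s) (2 ^ k * P : R).
    rewrite -pow2D_prec -[in k + p%:Z](subnKC (ltnW sp)) PoszD addrA.
    exact: grid_addn (grid_pow2 _).
  apply: grid_norm_le kzza kPs _.
  have := ler_normD a (z - a - za).
  have -> : a + (z - a - za) = z - za by ring.
  rewrite [`|z - a - za|]distrC ksE; lra.
have ahE : ah = z - za.
  apply: nearest_float Nah _; apply: (grid_float kzza).
  by apply: le_trans zza _; rewrite ksE.
have aah : `|a - ah| <= 2 ^ k * 2 ^+ s / 2.
  by rewrite ahE; have -> : a - (z - za) = za - (z - a) by ring.
have alE : al = a - ah.
  apply: nearest_float Nal _; apply: (@grid_float k); last by lra.
  by rewrite ahE; apply: gridB => //; exact: grid_addn kzza.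
by rewrite -alE in aah; rewrite ahE in alE *.
Qed.

(** Each significand is split into two halves of at most [p / 2] bits, so the
    partial products are floats. Subtracting them from [x] in order of decreasing
    size makes each difference small by the time its grid becomes fine, hence a
    float; the last difference is the rounding error itself. *)
Lemma dekker_product_exact (s : nat) k l a b ah al bh bl x hh lh hl ll d1 d2 d3 y :
  (s.+2 <= p)%N -> (p <= s + s)%N -> (s + s <= p.+1)%N ->
  on_grid k a -> 2 ^ k * P / 2 <= `|a| < 2 ^ k * P ->
  on_grid l b -> 2 ^ l * P / 2 <= `|b| < 2 ^ l * P ->
  [/\ on_grid (k + s) ah, `|ah| <= 2 ^ k * P,
      al = a - ah & `|al| <= 2 ^ k * 2 ^+ s / 2] ->
  [/\ on_grid (l + s) bh, `|bh| <= 2 ^ l * P,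
      bl = b - bh & `|bl| <= 2 ^ l * 2 ^+ s / 2] ->
  nearest (a * b) x ->
  nearest (ah * bh) hh -> nearest (al * bh) lh -> nearest (ah * bl) hl ->
  nearest (al * bl) ll ->
  nearest (x - hh) d1 -> nearest (d1 - lh) d2 -> nearest (d2 - hl) d3 ->
  nearest (ll - d3) y ->
  y = a * b - x.
Proof.
move=> sp ps sp' ka /andP[ka1 /ltW ka2] lb /andP[lb1 /ltW lb2].
move=> [kah ah_le alE al_le] [lbh bh_le blE bl_le] abx Nhh Nlh Nhl Nll Nd1 Nd2 Nd3 Ny.
have P0 := prec_pow2_gt0; have P16 := prec_pow2_ge16.
have S1 : 1 <= 2 ^+ s :> R by apply: exprn_ege1; lra.
have S_le : 2 ^+ s * 4 <= P :> R.
  have -> : 2 ^+ s * 4 = 2 ^+ s.+2 :> R by rewrite !exprSr; ring.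
  by apply: ler_weXn2l sp; lra.
have SS_ge : P <= 2 ^+ s * 2 ^+ s :> R.
  by rewrite -exprD; apply: ler_weXn2l ps; lra.
have SS_le : 2 ^+ s * 2 ^+ s <= P * 2 :> R.
  by rewrite -exprD -exprSr; apply: ler_weXn2l sp'; lra.
have P_half_le : P / 2 <= P :> R by lra.
have S_half : 2 ^+ s / 2 <= 2 ^+ s :> R by lra.
have SS_quarter : 2 ^+ s / 2 * (2 ^+ s / 2) <= P :> R by lra.
have kal : on_grid k al by rewrite alE; apply: gridB => //; exact: grid_addn kah.
have lbl : on_grid l bl by rewrite blE; apply: gridB => //; exact: grid_addn lbh.
have gab := gridM ka lb.
have ghh : on_grid (k + l + (s + s)%N%:Z) (ah * bh).
  by rewrite PoszD addrACA; exact: gridM.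
have glh : on_grid (k + l + s) (al * bh) by rewrite -addrA; exact: gridM.
have ghl : on_grid (k + l + s) (ah * bl) by rewrite addrAC; exact: gridM.
have gll := gridM kal lbl.
have qE : 2 ^ (k + l) = 2 ^ k * 2 ^ l :> R := pow2D k l.
have k0 := pow2_gt0 (R := R) k; have l0 := pow2_gt0 (R := R) l.
have q0 := pow2_gt0 (R := R) (k + l).
have qsE n : 2 ^ (k + l + n%:Z) = 2 ^ (k + l) * 2 ^+ n :> R by rewrite pow2D.
have norm_mul (c d C D : R) : `|c| <= 2 ^ k * C -> `|d| <= 2 ^ l * D ->
    `|c * d| <= 2 ^ (k + l) * (C * D).
  by move=> cC dD; rewrite normrM qE mulrACA; exact: ler_pM.
have aS : `|al| <= 2 ^ k * (2 ^+ s / 2) by rewrite mulrA.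
have bS : `|bl| <= 2 ^ l * (2 ^+ s / 2) by rewrite mulrA.
have hh_le := norm_mul _ _ _ _ ah_le bh_le.
have lh_le := norm_mul _ _ _ _ aS bh_le.
have hl_le := norm_mul _ _ _ _ ah_le bS.
have ll_le := norm_mul _ _ _ _ aS bS.
have alb_le := norm_mul _ _ _ _ aS lb2.
have abl_le := norm_mul _ _ _ _ ka2 bS.
have ab_le := norm_mul _ _ _ _ ka2 lb2.
have ab_ge : 2 ^ (k + l) * (P / 2 * (P / 2)) <= `|a * b|.
  have kP0 (i : int) : 0 <= 2 ^ i * (P / 2) :> R.
    by rewrite mulr_ge0 ?divr_ge0// ltW ?pow2_gt0.
  by rewrite normrM qE mulrACA; apply: ler_pM => //; rewrite mulrA.
have qP (c d : R) : (2 ^ (k + l) * c <= 2 ^ (k + l) * d) = (c <= d) := ler_pM2l q0 c d.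
have hhE : hh = ah * bh.
  apply: nearest_float Nhh _; apply: (grid_float ghh).
  by apply: (le_trans hh_le); rewrite qsE -[leRHS]mulrA exprD qP ler_pM2r//.
have lhE : lh = al * bh.
  apply: nearest_float Nlh _; apply: (grid_float glh).
  by apply: (le_trans lh_le); rewrite qsE -[leRHS]mulrA qP ler_pM2r//.
have hlE : hl = ah * bl.
  apply: nearest_float Nhl _; apply: (grid_float ghl).
  by apply: (le_trans hl_le); rewrite qsE -[leRHS]mulrA qP [P * _]mulrC ler_pM2r//.
have llE : ll = al * bl.
  apply: nearest_float Nll _; apply: (grid_float gll).
  by apply: (le_trans ll_le); rewrite qP.
have gx : on_grid (k + l + p.-1%:Z) x.
  apply: nearest_grid_ge abx _; move: ab_ge; congr (_ <= _).
  by rewrite qsE prec_pow2_half; ring.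
have err : `|x - a * b| <= 2 ^ (k + l) * (P / 2).
  have -> : 2 ^ (k + l) * (P / 2) = 2 ^ (k + l + p%:Z) / 2 :> R by rewrite pow2D_prec; ring.
  by apply: nearest_half_ulp abx _; rewrite pow2D_prec -mulrA.
have s_le_p1 : (s <= p.-1)%N by rewrite -ltnS prednK ?(ltn_trans _ sp)// ltnW.
have gxs : on_grid (k + l + s) x.
  by move: gx; rewrite -(subnKC s_le_p1) PoszD addrA; exact: grid_addn.
have qPS : 2 ^ (k + l) * (2 ^+ s * P * 4) <= 2 ^ (k + l) * (P * P) :> R.
  by rewrite qP mulrAC ler_pM2r//.
have qPS1 : 2 ^ (k + l) * (P * 1) <= 2 ^ (k + l) * (P * 2 ^+ s) :> R.
  by rewrite qP ler_pM2l.
have qPP : 2 ^ (k + l) * (P * 16) <= 2 ^ (k + l) * (P * P) :> R.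
  by rewrite qP ler_pM2l.
have qPP0 : 0 <= 2 ^ (k + l) * (P * P) :> R by rewrite !mulr_ge0 ?(ltW q0) ?(ltW P0).
have qSS : 2 ^ (k + l) * (2 ^+ s * 2 ^+ s) <= 2 ^ (k + l) * (P * 2) :> R.
  by rewrite qP.
have d1E : d1 = x - ah * bh.
  rewrite hhE in Nd1; apply: nearest_float Nd1 _.
  apply: (@grid_float (k + l + p.-1%:Z)).
    apply: gridB => //; move: ghh; have pss : (p.-1 <= s + s)%N by rewrite (leq_trans (leq_pred _)).
    by rewrite -(subnKC pss) PoszD addrA; exact: grid_addn.
  have -> : x - ah * bh = x - a * b + ah * bl + al * b by rewrite alE blE; ring.
  rewrite qsE prec_pow2_half.
  have := ler_normD (x - a * b + ah * bl) (al * b).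
  have := ler_normD (x - a * b) (ah * bl).
  by move: err hl_le alb_le qPS qPP qPP0; clear; lra.
have d2E : d2 = d1 - al * bh.
  rewrite lhE in Nd2; apply: nearest_float Nd2 _; rewrite d1E.
  apply: (@grid_float (k + l + s)).
    apply: gridB => //; apply: gridB => //.
    by move: ghh; rewrite PoszD addrA; exact: grid_addn.
  have -> : x - ah * bh - al * bh = x - a * b + a * bl by rewrite alE blE; ring.
  rewrite qsE; have := ler_normD (x - a * b) (a * bl).
  by move: err abl_le qPS1; clear; lra.
have d3E : d3 = x - a * b + al * bl.
  have e : d2 - ah * bl = x - a * b + al * bl by rewrite d2E d1E alE blE; ring.
  rewrite hlE in Nd3; rewrite -e; apply: nearest_float Nd3 _.
  apply: (@grid_float (k + l)).
    by rewrite e; apply: gridD => //; apply: gridB => //; exact: grid_addn gx.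
  rewrite e; have := ler_normD (x - a * b) (al * bl).
  by move: err ll_le qSS; clear; lra.
have e : ll - d3 = a * b - x by rewrite llE d3E; ring.
rewrite -e; apply: nearest_float Ny _; rewrite e; apply: (@grid_float (k + l)).
  by apply: gridB => //; exact: grid_addn gx.
by rewrite distrC (le_trans err)// qP.
Qed.


End Rounding.

(** * Error-free transformations *)

Section Algorithms.
Set Implicit Arguments.
Unset Strict Implicit.
Context {R : realType} (fp : ieee_arith R).
Implicit Types (a b c d r f x y s w z B : R) (n : nat) (k l : int) (p pp ps q : seq R).

Local Notation float := (unbounded_floats (R := R) (prec fp)).
Local Notation nearest := (is_nearest float).
Local Notation u := (unit_roundoff fp).
Local Notation prec4 := (prec_ge4 fp).

Lemma obind_some (A B : Type) (h : A -> option B) (o : option A) (v : B) :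
  obind h o = Some v -> exists2 w, o = Some w & h w = Some v.
Proof. by case: o => // w; exists w. Qed.
Local Notation unbind := (@obind_some _ _ _ _ _).

Lemma floats_unbounded x : floats fp x -> float x.
Proof. by case=> [->|[e _ ex]]; [left | right; exists e]. Qed.

Lemma fl_some r f : fl fp r = Some f -> floats fp f /\ nearest r f.
Proof.
rewrite /fl; case: ifPn => // /set_mem Ff [<-].
by split => //; exact: rnd_nearest.
Qed.

Lemma fl_nearest r f : fl fp r = Some f -> nearest r f.
Proof. by case/fl_some. Qed.

Lemma fl_floats r f : fl fp r = Some f -> floats fp f.
Proof. by case/fl_some. Qed.

Lemma fdiv_nearest a b f : fdiv fp a b = Some f -> nearest (a / b) f.
Proof. by rewrite /fdiv; case: ifP => // _ /fl_nearest. Qed.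

Lemma nearest0 f : nearest 0 f -> f = 0.
Proof. by move=> /nearest_float; apply; exact: float0. Qed.

Lemma TwoSum_exact a b x y : TwoSum fp a b = Some (x, y) ->
  floats fp a -> floats fp b -> [/\ floats fp x, nearest (a + b) x & a + b = x + y].
Proof.
move=> + /floats_unbounded Fa /floats_unbounded Fb.
rewrite /TwoSum => /unbind[x' /fl_some[Fx Nx]].
move=> /unbind[z /fl_nearest Nz] /unbind[xz /fl_nearest Nxz].
move=> /unbind[y1 /fl_nearest Ny1] /unbind[y2 /fl_nearest Ny2].
move=> /unbind[y' /fl_nearest Ny] [<- <-]; split => //.
by rewrite (two_sum_exact prec4 Fa Fb Nx Nz Nxz Ny1 Ny2 Ny); ring.
Qed.

(** The first bound, which needs a precision of at least 4, leaves room for the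
    digits of the difference between the rounded product and the product of the
    heads. *)
Lemma uphalf_prec_bounds : let h := uphalf (prec fp) in
  [/\ (h.+2 <= prec fp)%N, (prec fp <= h + h)%N & (h + h <= (prec fp).+1)%N].
Proof. by have := prec4; rewrite /=; split; lia. Qed.

Lemma fp_split_normal k a ah al : fp_split fp a = Some (ah, al) ->
  on_grid k a -> 2 ^ k * 2 ^+ prec fp / 2 <= `|a| < 2 ^ k * 2 ^+ prec fp ->
  [/\ on_grid (k + uphalf (prec fp)) ah, `|ah| <= 2 ^ k * 2 ^+ prec fp,
      al = a - ah & `|al| <= 2 ^ k * 2 ^+ uphalf (prec fp) / 2].
Proof.
move=> + ka a_bounds; rewrite /fp_split => /unbind[z /fl_nearest Nz].
move=> /unbind[za /fl_nearest Nza] /unbind[x /fl_nearest Nx].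
move=> /unbind[y /fl_nearest Ny] [<- <-].
have [h2 _ _] := uphalf_prec_bounds.
by apply: (veltkamp_split prec4 _ ka a_bounds Nz Nza Nx Ny); exact: ltnW.
Qed.

Lemma fp_split0 ah al : fp_split fp 0 = Some (ah, al) -> ah = 0 /\ al = 0.
Proof.
rewrite /fp_split => /unbind[z /fl_nearest].
rewrite mul0r => /nearest0 -> /unbind[za /fl_nearest].
rewrite subrr => /nearest0 -> /unbind[x /fl_nearest].
rewrite subrr => /nearest0 -> /unbind[y /fl_nearest].
by rewrite subrr => /nearest0 -> [<- <-].
Qed.

Lemma TwoProd_exact a b x y : TwoProd fp a b = Some (x, y) ->
  floats fp a -> floats fp b -> floats fp x /\ a * b = x + y.
Proof.
move=> + /floats_unbounded Fa /floats_unbounded Fb.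
rewrite /TwoProd => /unbind[x' /fl_some[Fx Nx]].
move=> /unbind[[ah al] Sa] /unbind[[bh bl] Sb].
move=> /unbind[hh /fl_nearest Nhh] /unbind[lh /fl_nearest Nlh].
move=> /unbind[hl /fl_nearest Nhl] /unbind[ll /fl_nearest Nll].
move=> /unbind[d1 /fl_nearest Nd1] /unbind[d2 /fl_nearest Nd2].
move=> /unbind[d3 /fl_nearest Nd3] /unbind[y' /fl_nearest Ny] [<- <-].
split => //.
have [ab0|] := boolP ((a == 0) || (b == 0)).
  have [abE hhE lhE hlE llE] : [/\ a * b = 0, ah * bh = 0, al * bh = 0, ah * bl = 0
      & al * bl = 0].
    case/orP: ab0 => /eqP e0; [move: Sa|move: Sb]; rewrite e0;
      by move=> /fp_split0[-> ->]; rewrite ?mulr0 ?mul0r.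
  move: Nx Nhh Nlh Nhl Nll; rewrite abE hhE lhE hlE llE.
  move=> /nearest0 x0 /nearest0 hh0 /nearest0 lh0 /nearest0 hl0 /nearest0 ll0.
  move: Nd1; rewrite x0 hh0 subrr => /nearest0 d10.
  move: Nd2; rewrite d10 lh0 subrr => /nearest0 d20.
  move: Nd3; rewrite d20 hl0 subrr => /nearest0 d30.
  by move: Ny; rewrite ll0 d30 subrr => /nearest0 ->; rewrite addr0.
rewrite negb_or => /andP[a0 b0].
have [k ka a_bounds] := float_normal prec4 Fa a0.
have [l lb b_bounds] := float_normal prec4 Fb b0.
have [h1 h2 h3] := uphalf_prec_bounds.
have Da := fp_split_normal Sa ka a_bounds.
have Db := fp_split_normal Sb lb b_bounds.
rewrite (dekker_product_exact prec4 h1 h2 h3 ka a_bounds lb b_bounds Da Db Nx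
  Nhh Nlh Nhl Nll Nd1 Nd2 Nd3 Ny).
by ring.
Qed.

Lemma EFTHorner_exact p x s pp ps : (forall i, floats fp p`_i) -> floats fp x ->
  EFTHorner fp p x = Some (s, pp, ps) ->
  [/\ floats fp s, size pp = (size p).-1, size ps = (size p).-1 &
      horner_rec p x = s + (horner_rec pp x + horner_rec ps x)].
Proof.
move=> + Fx; elim: p s pp ps => [|a p IH] s pp ps Fp.
  by move=> [<- <- <-]; split; [left | | | rewrite /= !addr0].
have Fa : floats fp a := Fp 0%N.
have {}Fp (i : nat) : floats fp p`_i := Fp i.+1.
case: p IH Fp => [|b p] IH Fp.
  by move=> [<- <- <-]; split => //=; rewrite mul0r add0r !addr0.
move=> /unbind[[[s' pp'] ps'] /(IH _ _ _ Fp)[Fs' spp' sps' E]].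
move=> /unbind[[q e1] /TwoProd_exact /(_ Fs' Fx)[Fq qE]].
move=> /unbind[[s1 e2] /TwoSum_exact /(_ Fq Fa)[Fs1 _ s1E]] [<- <- <-].
split => //=; rewrite ?spp' ?sps' //.
change (horner_rec (b :: p) x * x + a = s1 +
  (horner_rec pp' x * x + e1 + (horner_rec ps' x * x + e2))).
have -> : s1 = q + a - e2 by rewrite s1E addrK.
by rewrite E mulrDl qE; ring.
Qed.

(** * Error analysis of the correction *)

Lemma unit_roundoff_gt0 : 0 < u.
Proof. exact: roundoff_gt0. Qed.

Lemma rounding_error r f :
  nearest r f -> `|f - r| <= u * `|r| /\ `|f - r| <= u * `|f|.
Proof. by move=> rf; apply: (nearest_relative prec4 rf). Qed.

Lemma nearest_ge0 r f : nearest r f -> 0 <= r -> 0 <= f.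
Proof.
case=> _ minf r0; rewrite leNgt; apply/negP => f0.
by have := minf 0 (float0 _); rewrite ltr0_norm ?sub0r ?normrN ?ger0_norm; lra.
Qed.

Lemma nearest_upper r f : nearest r f -> 0 <= r -> r <= (1 + u) * f.
Proof.
move=> rf r0; have f0 := nearest_ge0 rf r0; have [_] := rounding_error rf.
by rewrite (ger0_norm f0) distrC => /(le_trans (ler_norm _)); lra.
Qed.

Lemma pow_1Du_ge1 n : 1 <= (1 + u) ^+ n.
Proof. by apply: exprn_ege1; have := unit_roundoff_gt0; lra. Qed.

(** [v] stands for the computed value and [w] the exact value of an expression whose
    terms each undergo at most [n] roundings, the absolute values of these terms
    adding up to at most [B]. *)
Definition approx n (B v w : R) := `|v - w| <= ((1 + u) ^+ n - 1) * B /\ `|w| <= B.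

Lemma approx_round n B v w f : approx n B v w -> nearest v f -> approx n.+1 B f w.
Proof.
move=> [vw wB] /rounding_error[vf _]; split => //.
have u0 := unit_roundoff_gt0.
have vB : `|v| <= (1 + u) ^+ n * B.
  by have := ler_normD (v - w) w; rewrite subrK; lra.
have : u * `|v| <= u * ((1 + u) ^+ n * B) by rewrite ler_pM2l.
have := ler_normD (f - v) (v - w); rewrite addrA subrK exprSr; lra.
Qed.

Lemma approxD n B v w B' v' w' :
  approx n B v w -> approx n B' v' w' -> approx n (B + B') (v + v') (w + w').
Proof.
move=> [vw wB] [vw' wB']; split.
  rewrite opprD addrACA; have := ler_normD (v - w) (v' - w'); lra.
by have := ler_normD w w'; lra.
Qed.

Lemma approx_weaken n m B v w : (n <= m)%N -> approx n B v w -> approx m B v w.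
Proof.
move=> nm [vw wB]; split => //; apply: le_trans vw _.
apply: ler_wpM2r; first exact: le_trans wB.
by rewrite lerD2r; apply: ler_weXn2l nm; have := unit_roundoff_gt0; lra.
Qed.

Lemma approxMr n B v w x : approx n B v w -> approx n (B * `|x|) (v * x) (w * x).
Proof.
move=> [vw wB]; split; last by rewrite normrM ler_wpM2r.
by rewrite -mulrBl normrM mulrA ler_wpM2r.
Qed.

Lemma approx_exact w : approx 0 `|w| w w.
Proof. by split; rewrite ?subrr ?normr0 ?mul0r. Qed.

Definition norms p := [seq `|c| | c <- p].

Lemma correction_approx pp ps q x c : size pp = size ps ->
  poly_fadd fp pp ps = Some q -> Horner fp q x = Some c ->
  approx (2 * size pp - 1)
    (horner_rec (norms pp) `|x| + horner_rec (norms ps) `|x|) c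
    (horner_rec pp x + horner_rec ps x).
Proof.
elim: pp ps q c => [|a pp IH] [|b ps] // q c.
  move=> _ [<-] [<-]; have := approx_exact 0.
  by rewrite normr0 /= addr0.
move=> [size_ps] /unbind[d /fl_nearest Nd] /unbind[q' q'E] [<-].
have ad : approx 1 (`|a| + `|b|) d (a + b).
  by apply: approx_round Nd; apply: approxD; exact: approx_exact.
case: q' q'E => [|d' q'] q'E.
  move=> [<-]; move: ad.
  case: pp IH size_ps q'E => [|a' pp] IH; case: ps => [|b' ps] //=.
    by rewrite !mul0r !add0r.
  by move=> _ /unbind[? _] /unbind[? _].
move=> /unbind[r /(IH _ _ _ size_ps q'E) Ar] /unbind[t /fl_nearest Nt].
move=> /fl_nearest Nc.
have spp : (0 < size pp)%N by case: pp {IH Ar size_ps} q'E.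
have At := approx_round (approxMr x Ar) Nt.
have le1 : (1 <= (2 * size pp - 1).+1)%N by [].
have := approx_round (approxD At (approx_weaken le1 ad)) Nc.
have -> : (2 * size pp - 1).+2 = (2 * size (a :: pp) - 1)%N by rewrite /=; lia.
by rewrite /= !mulrDl; congr approx; ring.
Qed.

Lemma norms_ge0 p x : 0 <= horner_rec (norms p) `|x|.
Proof. by elim: p => //= a p IH; rewrite addr_ge0// mulr_ge0. Qed.

(** All the quantities being nonnegative, each rounding loses at most a factor
    [1 + u]. *)
Lemma abs_correction_upper pp ps q x b : size pp = size ps ->
  poly_fadd fp (norms pp) (norms ps) = Some q -> Horner fp q `|x| = Some b ->
  0 <= b /\
  horner_rec (norms pp) `|x| + horner_rec (norms ps) `|x|
    <= (1 + u) ^+ (2 * size pp - 1) * b.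
Proof.
have u0 := unit_roundoff_gt0.
elim: pp ps q b => [|a pp IH] [|a' ps] // q b.
  by move=> _ [<-] [<-]; rewrite mulr0 /= addr0.
move=> [size_ps] /unbind[d /fl_nearest Nd] /unbind[q' q'E] [<-].
have d0 : 0 <= d by apply: nearest_ge0 Nd _; exact: addr_ge0.
have dU := nearest_upper Nd (addr_ge0 (normr_ge0 _) (normr_ge0 _)).
case: q' q'E => [|d' q'] q'E.
  move=> [<-]; split => //; move: dU.
  case: pp IH size_ps q'E => [|a1 pp] IH; case: ps => [|b' ps] //=.
    by rewrite !mul0r !add0r.
  by move=> _ /unbind[? _] /unbind[? _].
move=> /unbind[r /(IH _ _ _ size_ps q'E)[r0 rU]] /unbind[t /fl_nearest Nt].
move=> /fl_nearest Nb.
have spp : (0 < size pp)%N by case: pp {IH rU size_ps} q'E.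
have t0 := nearest_ge0 Nt (mulr_ge0 r0 (normr_ge0 x)).
have tU := nearest_upper Nt (mulr_ge0 r0 (normr_ge0 x)).
have bU := nearest_upper Nb (addr_ge0 t0 d0).
split; first by apply: nearest_ge0 Nb _; exact: addr_ge0.
have -> : (2 * size (a :: pp) - 1)%N = (2 * size pp - 1).+2 by rewrite /=; lia.
set n := (2 * size pp - 1)%N in rU *; set U := (1 + u) ^+ n in rU *.
have U1 : 1 <= U by exact: pow_1Du_ge1.
have U0 : 0 <= U * (1 + u) by rewrite mulr_ge0; lra.
have rxU := ler_wpM2r (normr_ge0 x) rU.
have tU' : U * (r * `|x|) <= U * ((1 + u) * t) by rewrite ler_wpM2l//; lra.
have bU' := ler_wpM2l U0 bU.
have dU' : (1 + u) * d <= U * (1 + u) * d.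
  by rewrite ler_wpM2r// ler_peMl//; lra.
rewrite !exprSr -/U /=; lra.
Qed.

(** A consequence of Bernoulli's inequality, in the form that absorbs a product of
    relative errors into a quotient. *)
Lemma pow_1Du_le1 n : (1 + u) ^+ n * (1 - n%:R * u) <= 1.
Proof.
have u0 := unit_roundoff_gt0.
elim: n => [|n IH]; first by rewrite mul0r subr0 mulr1.
apply: le_trans IH; rewrite exprSr -mulrA ler_wpM2l//.
  by rewrite exprn_ge0//; lra.
rewrite -natr1; have : 0 <= (n%:R + 1) * u * u.
  by rewrite !mulr_ge0 ?ltW// ltr_wpDl.
by lra.
Qed.

(** Integer multiples of [u] up to 1 are floats, so the constants in the computed
    bounds are exact. *)
Lemma float_mul_roundoff n : n%:R * u < 1 -> float (n%:R * u) /\ float (1 - n%:R * u).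
Proof.
move=> nu; have nu0 : 0 <= n%:R * u by rewrite mulr_ge0// ltW// unit_roundoff_gt0.
have gn : on_grid (- (prec fp)%:Z) (n%:R * u).
  by rewrite -[- _]add0r; apply: gridM; [exact: grid_nat | exact: grid_pow2].
have g1 : on_grid (- (prec fp)%:Z) (1 : R).
  by apply: (grid_addn (n := prec fp)); rewrite addNr (grid_nat 1).
have uP : 2 ^ (- (prec fp)%:Z) * 2 ^+ prec fp = 1 :> R := roundoffE _.
split; apply: (grid_float prec4 (k := - (prec fp)%:Z)); rewrite ?uP //.
- by rewrite ger0_norm// ltW.
- exact: gridB.
- by rewrite ger0_norm; lra.
Qed.

(** * The computed bounds and faithful rounding *)

(** Of the [2n + 2] factors [1 + u] cancelled by the final division, [2n - 1] come
    from the computed value of [B], and one each from the quotient in [gamma], the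
    product and the final division. *)
Lemma alpha_hat_bound n pp ps x alpha :
  (1 <= n)%N -> (2 * (n + 1))%:R * u < 1 -> size pp = n -> size ps = n ->
  alpha_hat fp n pp ps x = Some alpha ->
  ((1 + u) ^+ (2 * n - 1) - 1)
    * (horner_rec (norms pp) `|x| + horner_rec (norms ps) `|x|) <= alpha.
Proof.
move=> n1 nu spp sps; set N := (2 * (n + 1))%N in nu; set k := (2 * n - 1)%N.
rewrite /alpha_hat -/k -/N => /unbind[q qE] /unbind[b bE] /unbind[g gE].
move=> /unbind[gb /fl_nearest Ngb] /unbind[v /fl_nearest Nv].
move=> /unbind[d /fl_nearest Nd] /fdiv_nearest Nalpha.
have size_eq : size pp = size ps by rewrite spp sps.
have := abs_correction_upper size_eq qE bE; rewrite spp -/k.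
set B := _ + _ => -[b0 BU].
have u0 := unit_roundoff_gt0; have U0 : 0 <= 1 + u by lra.
have kN : k.+3 = N by rewrite /k /N; lia.
have NkE : N%:R = k%:R + 3 :> R by rewrite -kN -addn3 natrD.
have ku : k%:R * u < 1 by rewrite NkE in nu; lra.
have [FN1 FN2] := float_mul_roundoff nu; have [Fk1 Fk2] := float_mul_roundoff ku.
rewrite (nearest_float Nv FN1) in Nd; rewrite (nearest_float Nd FN2) in Nalpha.
move: gE => /unbind[c /fl_nearest Nc] /unbind[e /fl_nearest Ne] /fdiv_nearest Ng.
have cE := nearest_float Nc Fk1; rewrite cE in Ne Ng.
rewrite (nearest_float Ne Fk2) in Ng.
have dk : 0 < 1 - k%:R * u by lra.
have dN : 0 < 1 - N%:R * u by lra.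
have ku0 : 0 <= k%:R * u by rewrite mulr_ge0 ?(ltW u0).
have gamma0 : 0 <= k%:R * u / (1 - k%:R * u) by rewrite divr_ge0 ?(ltW dk).
have g0 := nearest_ge0 Ng gamma0; have gU := nearest_upper Ng gamma0.
have gb0 := nearest_ge0 Ngb (mulr_ge0 g0 b0).
have gbU := nearest_upper Ngb (mulr_ge0 g0 b0).
have quot0 : 0 <= gb / (1 - N%:R * u) by rewrite divr_ge0 ?(ltW dN).
have alpha0 := nearest_ge0 Nalpha quot0.
have := nearest_upper Nalpha quot0; rewrite ler_pdivrMr// => alphaU.
have powk : (1 + u) ^+ k - 1 <= k%:R * u / (1 - k%:R * u).
  by rewrite ler_pdivlMr//; have := pow_1Du_le1 k; lra.
have pow0 : 0 <= (1 + u) ^+ k - 1 by rewrite subr_ge0 pow_1Du_ge1.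
have Uk0 : 0 <= (1 + u) ^+ k by rewrite exprn_ge0.
have B0 : 0 <= B by rewrite addr_ge0 ?norms_ge0.
apply: (@le_trans _ _ (((1 + u) * g) * ((1 + u) ^+ k * b))).
  by apply: ler_pM => //; exact: le_trans powk gU.
apply: (@le_trans _ _ ((1 + u) ^+ k.+1 * ((1 + u) * gb))).
  have -> : (1 + u) * g * ((1 + u) ^+ k * b) = (1 + u) ^+ k.+1 * (g * b).
    by rewrite exprS; ring.
  by rewrite ler_wpM2l// exprn_ge0.
apply: (@le_trans _ _ ((1 + u) ^+ k.+2 * ((1 + u) * alpha * (1 - N%:R * u)))).
  by rewrite mulrA -exprSr ler_wpM2l// exprn_ge0.
have -> : (1 + u) ^+ k.+2 * ((1 + u) * alpha * (1 - N%:R * u)) =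
    (1 + u) ^+ N * (1 - N%:R * u) * alpha by rewrite -kN [in RHS]exprSr; ring.
by rewrite ler_piMl// pow_1Du_le1.
Qed.

Lemma error_bound_upper s e bound : 2 * u < 1 -> 0 <= s ->
  error_bound fp s e = Some bound -> s + `|e| <= bound.
Proof.
move=> u2 s0; rewrite /error_bound => /unbind[t /fl_nearest Nt].
move=> /unbind[v /fl_nearest Nv] /unbind[d /fl_nearest Nd] /fdiv_nearest Nb.
have u0 := unit_roundoff_gt0.
have [F1 F2] := float_mul_roundoff u2.
rewrite (nearest_float Nv F1) in Nd; rewrite (nearest_float Nd F2) in Nb.
have se0 : 0 <= s + `|e| by rewrite addr_ge0.
have t0 := nearest_ge0 Nt se0; have tU := nearest_upper Nt se0.
have d0 : 0 < 1 - 2 * u by lra.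
have quot0 : 0 <= t / (1 - 2 * u) by rewrite divr_ge0 ?(ltW d0).
have b0 := nearest_ge0 Nb quot0.
have := nearest_upper Nb quot0; rewrite ler_pdivrMr// => bU.
apply: (le_trans tU); apply: (@le_trans _ _ ((1 + u) * ((1 + u) * bound * (1 - 2 * u)))).
  by rewrite ler_pM2l//; lra.
have -> : (1 + u) * ((1 + u) * bound * (1 - 2 * u)) =
    (1 + u) ^+ 2 * (1 - 2%:R * u) * bound by ring.
by rewrite ler_piMl// pow_1Du_le1.
Qed.

(** Any other float [g] is at least [u * `|f|] away from [f], and [r] lies on the
    near side of the midpoint of [g] and [f]; a perturbation by less than half of
    this gap does not reach [g]. *)
Lemma faithful_perturbation r f d :
  floats fp f -> nearest r f -> `|d| < u / 2 * `|f| ->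
  faithful_rounding fp f (r + d).
Proof.
move=> Ff [_ minf] du; split => //.
have gap g : floats fp g -> g != f -> u * `|f| <= `|f - g|.
  by move=> Fg; apply: (float_gap prec4); exact: floats_unbounded.
have h : 0 < u / 2 * `|f| - `|d| by rewrite subr_gt0.
apply/andP; split.
  apply: (@le_lt_trans _ _ (r + d - (u / 2 * `|f| - `|d|))%:E); last first.
    by rewrite lte_fin ltrBlDr ltrDl.
  apply: ge_ereal_sup => _ [g [Fg gf] <-]; rewrite lee_fin.
  have := gap g Fg (negbT (lt_eqF gf)).
  have fg0 : 0 <= f - g by rewrite subr_ge0 ltW.
  rewrite (ger0_norm fg0) => gap_g.
  have mid : f - r <= r - g.
    have := minf g (floats_unbounded Fg); have := ler_norm (f - r).
    by case: (ger0P (g - r)); lra.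
  by have := ler_norm (- d); rewrite normrN; lra.
apply: (@lt_le_trans _ _ (r + d + (u / 2 * `|f| - `|d|))%:E).
  by rewrite lte_fin ltrDl.
apply: le_ereal_inf_tmp => _ [g [Fg fg] <-]; rewrite lee_fin.
have := gap g Fg (negbT (gt_eqF fg)).
have fg0 : f - g <= 0 by rewrite subr_le0 ltW.
rewrite (ler0_norm fg0) => gap_g.
have mid : r - f <= g - r.
  have := minf g (floats_unbounded Fg); have := ler_norm (- (f - r)).
  by rewrite normrN; case: (ger0P (g - r)); lra.
by have := ler_norm d; lra.
Qed.

Lemma Horner_floats p x r : (forall c, c \in p -> floats fp c) ->
  Horner fp p x = Some r -> floats fp r.
Proof.
case: p => [|a [|b p]] Fp; first by move=> [<-]; left.
  by move=> [<-]; apply: Fp; rewrite mem_head.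
by move=> /unbind[? _] /unbind[? _] /fl_floats.
Qed.

Lemma poly_fadd_floats pp ps q :
  poly_fadd fp pp ps = Some q -> forall c, c \in q -> floats fp c.
Proof.
elim: pp ps q => [|a pp IH] [|b ps] q; try by move=> [<-].
move=> /unbind[d /fl_floats Fd] /unbind[q' /IH Fq] [<-] c.
by rewrite inE => /orP[/eqP ->|/Fq].
Qed.

End Algorithms.

Theorem theorem9 (R : realType) (fp : ieee_arith R) (n : nat) (p : {poly R}) (x : R)
    (rhat chat rbar alpha : R) (ppi psigma : seq R)
    (n_ge1 : (1 <= n)%N)
    (n_small : (2 * (n + 1))%:R * unit_roundoff fp < 1)
    (p_degree : size p = n.+1)
    (p_floats : forall i : nat, floats fp p`_i)
    (x_float : floats fp x)
    (EFTHornerE : EFTHorner fp p x = Some (rhat, ppi, psigma))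
    (chatE : correction fp ppi psigma x = Some chat)
    (rbarE : CompHorner fp p x = Some rbar)
    (alphaE : alpha_hat fp n ppi psigma x = Some alpha) :
  (alpha < unit_roundoff fp / 2 * `|rbar| -> faithful_rounding fp rbar p.[x]) /\
  (forall e bound : R,
     TwoSum fp rhat chat = Some (rbar, e) ->
     error_bound fp alpha e = Some bound ->
     rbar + e = rhat + chat /\ `|rbar - p.[x]| <= bound).
Proof.
have [Frhat size_pi size_sigma pxE] := EFTHorner_exact p_floats x_float EFTHornerE.
rewrite p_degree /= in size_pi size_sigma.
have size_eq : size ppi = size psigma by rewrite size_pi size_sigma.
move: rbarE; rewrite /CompHorner EFTHornerE /= chatE /= => /fl_some[Frbar Nrbar].
move: chatE; rewrite /correction; case qE: poly_fadd => [q|] //= HornerE.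
have Fchat := Horner_floats (poly_fadd_floats qE) HornerE.
have [+ _] := correction_approx size_eq qE HornerE; rewrite size_pi.
move=> /le_trans /(_ (alpha_hat_bound n_ge1 n_small size_pi size_sigma alphaE)).
set c := horner_rec ppi x + horner_rec psigma x => chat_err.
have pE : p.[x] = rhat + c := pxE.
split=> [alpha_small|e bound TwoSumE boundE].
  have -> : p.[x] = rhat + chat + (c - chat) by rewrite pE; ring.
  apply: faithful_perturbation => //.
  by rewrite distrC; apply: le_lt_trans alpha_small.
have [_ _ sumE] := TwoSum_exact TwoSumE Frhat Fchat; split => //.
have alpha0 : 0 <= alpha := le_trans (normr_ge0 _) chat_err.
have u2 : 2 * unit_roundoff fp < 1.
  apply: le_lt_trans n_small; rewrite ler_pM2r ?unit_roundoff_gt0// ler_nat.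
  by rewrite leq_pmulr // addn1.
apply: le_trans (error_bound_upper u2 alpha0 boundE).
have -> : rbar - p.[x] = (chat - c) - e.
  have -> : rbar = rhat + chat - e by rewrite sumE addrK.
  by rewrite pE; ring.
by apply: le_trans (ler_normB _ _) _; rewrite lerD2r.
Qed.
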